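(* Let $(K_n)_{n\in\mathbb{Z}}$ be the Tribonacci-Lucas sequence extended to all integers: $K_0=3$, $K_1=1$, $K_2=3$ and $K_n=K_{n-1}+K_{n-2}+K_{n-3}$ for all integers $n$. Then for every integer $n\ge 1$: (a) $\sum_{k=1}^{n}K_{-k}=\frac{1}{2}(-3K_{-n-1}-2K_{-n-2}-K_{-n-3}).$ (b) $\sum_{k=1}^{n}K_{-2k}=\frac{1}{2}(-K_{-2n+1}+K_{-2n}-2).$ (c) $\sum_{k=1}^{n}K_{-2k+1}=\frac{1}{2}(-K_{-2n}-K_{-2n-1}+2).$ *)

(* Defs.v *)
From mathcomp Require Import all_boot all_order all_algebra.
From mathcomp Require Import ring lra zify.

Set Implicit Arguments.
Unset Strict Implicit.
Unset Printing Implicit Defensive.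

Import Order.TTheory GRing.Theory Num.Theory.
Local Open Scope ring_scope.

Definition tribonacci_lucas (K : int -> int) : Prop :=
  [/\ K 0 = 3, K 1 = 1, K 2 = 3
    & forall n : int, K n = K (n - 1) + K (n - 2) + K (n - 3)].

(* The predicate is inhabited: iterate the recurrence forwards and backwards
   on the windows (K n, K (n + 1), K (n + 2)). *)
Definition tl_next (w : int * int * int) : int * int * int :=
  let: (a, b, c) := w in (b, c, a + b + c).
Definition tl_prev (w : int * int * int) : int * int * int :=
  let: (a, b, c) := w in (c - b - a, a, b).
Definition tl_window (n : int) : int * int * int :=
  match n with
  | Posz m => iter m tl_next (3, 1, 3)
  | Negz m => iter m.+1 tl_prev (3, 1, 3)
  end.

Lemma tl_prevK : cancel tl_prev tl_next.
Proof. by case=> [[a b] c] /=; congr (_, _, _); ring. Qed.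

Lemma tl_windowS (n : int) : tl_window (n + 1) = tl_next (tl_window n).
Proof.
case: n => [m|m]; first by rewrite -PoszD addn1.
rewrite -[tl_window (Negz m)]/(tl_prev (iter m tl_prev (3, 1, 3))) tl_prevK.
case: m => [|m] //.
by have -> : Negz m.+1 + 1 = Negz m by lia.
Qed.

Lemma tribonacci_lucas_exists : exists K : int -> int, tribonacci_lucas K.
Proof.
exists (fun n => (tl_window n).1.1); split=> // n.
have -> : n = n - 3 + 1 + 1 + 1 by ring.
have -> : n - 3 + 1 + 1 + 1 - 1 = n - 3 + 1 + 1 by ring.
have -> : n - 3 + 1 + 1 + 1 - 2 = n - 3 + 1 by ring.
have -> : n - 3 + 1 + 1 + 1 - 3 = n - 3 by ring.
rewrite !tl_windowS; case: (tl_window _) => [[a b] c] /=.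
ring.
Qed.

(* Main.v *)
(** Each right-hand side, doubled, vanishes at n = 0 and increases at step n by
    twice the n-th summand, by the recurrence; so all three sums telescope. *)
Require Import Defs.
From mathcomp Require Import all_boot all_order all_algebra.
From mathcomp Require Import ring zify.

Import Order.TTheory GRing.Theory Num.Theory.
Local Open Scope ring_scope.

(** Each sum telescopes against an explicit combination [F] of neighbouring values of [K]. One
    instance of the recurrence shows that [F] grows by twice the new summand, and [F 0 = 0] is a
    check on the values of [K] near 0. [sum_half_telescope] works with the doubled identity over the
    integers and halves only in the rationals. *)

Lemma sum_half_telescope (f F : nat -> int) (n : nat) :
  F 0%N = 0 -> (forall m, F m.+1 = F m + 2 * f m.+1) ->
  (\sum_(1 <= k < n.+1) f k)%:Q = 1 / 2 * (F n)%:Q.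
Proof.
move=> F0 FS; have <- : 2 * \sum_(1 <= k < n.+1) f k = F n.
  elim: n => [|n IHn]; first by rewrite big_geq // mulr0.
  by rewrite big_nat_recr //= mulrDr IHn FS.
by rewrite intrM; field.
Qed.

(** The indices are tied to [m] by equations, so the recurrence applies to them in whatever form
    they are written. *)
Lemma tribonacci_lucas_rec (K : int -> int) (m a b c d : int) :
  tribonacci_lucas K -> a = m + 3 -> b = m + 2 -> c = m + 1 -> d = m ->
  K a = K b + K c + K d.
Proof.
case=> _ _ _ rec -> -> -> ->; rewrite (rec (m + 3)).
by congr (K _ + K _ + K _); ring.
Qed.

(** Running the recurrence backwards from 0, 1, 2 gives the values needed for [F 0 = 0] in (a) and
    (c). *)
Lemma tribonacci_lucas_neg (K : int -> int) : tribonacci_lucas K ->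
  [/\ K (-1) = -1, K (-2) = -1 & K (-3) = 5].
Proof.
move=> hK; have [K0 K1 K2 _] := hK.
have r2 : K 2 = K 1 + K 0 + K (-1) by apply: (tribonacci_lucas_rec _ (-1)).
have r1 : K 1 = K 0 + K (-1) + K (-2) by apply: (tribonacci_lucas_rec _ (-2)).
have r0 : K 0 = K (-1) + K (-2) + K (-3).
  by apply: (tribonacci_lucas_rec _ (-3)).
by split; lia.
Qed.

Theorem corollary3p4 (K : int -> int) (hK : tribonacci_lucas K)
    (n : nat) (hn : (1 <= n)%N) :
  [/\ (\sum_(1 <= k < n.+1) K (- k%:Z))%:Q
        = 1 / 2 * (- 3 * K (- n%:Z - 1) - 2 * K (- n%:Z - 2)
                   - K (- n%:Z - 3))%:Q,
      (\sum_(1 <= k < n.+1) K (- 2 * k%:Z))%:Q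
        = 1 / 2 * (- K (- 2 * n%:Z + 1) + K (- 2 * n%:Z) - 2)%:Q
    & (\sum_(1 <= k < n.+1) K (- 2 * k%:Z + 1))%:Q
        = 1 / 2 * (- K (- 2 * n%:Z) - K (- 2 * n%:Z - 1) + 2)%:Q].
Proof.
have [K0 K1 _ _] := hK; have [KN1 KN2 KN3] := tribonacci_lucas_neg _ hK.
split.
- apply: (sum_half_telescope (fun k : nat => K (- k%:Z))
    (fun k : nat => - 3 * K (- k%:Z - 1) - 2 * K (- k%:Z - 2)
                    - K (- k%:Z - 3))) => [|m].
    by rewrite oppr0 !add0r KN1 KN2 KN3.
  (* The bare index [- m.+1%:Z] is rewritten last, since it occurs inside the others. *)
  have -> : - m.+1%:Z - 1 = - m%:Z - 2 by lia.
  have -> : - m.+1%:Z - 2 = - m%:Z - 3 by lia.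
  have -> : - m.+1%:Z - 3 = - m%:Z - 4 by lia.
  have -> : - m.+1%:Z = - m%:Z - 1 by lia.
  (* The increment is [3 * K (- m%:Z - 1)] minus the three preceding terms, which sum to
     [K (- m%:Z - 1)]. *)
  have r : K (- m%:Z - 1)
         = K (- m%:Z - 2) + K (- m%:Z - 3) + K (- m%:Z - 4).
    by apply: (tribonacci_lucas_rec _ (- m%:Z - 4)) => //; ring.
  by rewrite r; ring.
- apply: (sum_half_telescope (fun k : nat => K (- 2 * k%:Z))
    (fun k : nat => - K (- 2 * k%:Z + 1) + K (- 2 * k%:Z) - 2)) => [|m].
    by rewrite mulr0 add0r K0 K1.
  have -> : - 2 * m.+1%:Z + 1 = - 2 * m%:Z - 1 by lia.
  have -> : - 2 * m.+1%:Z = - 2 * m%:Z - 2 by lia.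
  (* Expanding the odd term of [F m] cancels everything in the increment but two copies of
     [K (- 2 * m%:Z - 2)]. *)
  have r : K (- 2 * m%:Z + 1)
         = K (- 2 * m%:Z) + K (- 2 * m%:Z - 1) + K (- 2 * m%:Z - 2).
    by apply: (tribonacci_lucas_rec _ (- 2 * m%:Z - 2)) => //; ring.
  by rewrite r; ring.
apply: (sum_half_telescope (fun k : nat => K (- 2 * k%:Z + 1))
  (fun k : nat => - K (- 2 * k%:Z) - K (- 2 * k%:Z - 1) + 2)) => [|m].
  by rewrite mulr0 add0r K0 KN1.
have -> : - 2 * m.+1%:Z + 1 = - 2 * m%:Z - 1 by lia.
have -> : - 2 * m.+1%:Z - 1 = - 2 * m%:Z - 3 by lia.
have -> : - 2 * m.+1%:Z = - 2 * m%:Z - 2 by lia.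
(* Here the even term is expanded, leaving two copies of [K (- 2 * m%:Z - 1)]. *)
have r : K (- 2 * m%:Z)
       = K (- 2 * m%:Z - 1) + K (- 2 * m%:Z - 2) + K (- 2 * m%:Z - 3).
  by apply: (tribonacci_lucas_rec _ (- 2 * m%:Z - 3)) => //; ring.
by rewrite r; ring.
Qed.
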